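(* Up to a global phase, there are exactly six POVM-incoherent unitaries of the qubit trine POVM, namely $$\begin{pmatrix}1&0\\0&1\end{pmatrix}=\mathbb 1,\quad \begin{pmatrix}\omega^{-1/2}&0\\0&\omega^{1/2}\end{pmatrix}=R_{\vec e_z}(\tfrac{2\pi}3),\quad \begin{pmatrix}\omega^{*}&0\\0&\omega\end{pmatrix}=R_{\vec e_z}(\tfrac{4\pi}3),$$ $$\begin{pmatrix}0&-i\\-i&0\end{pmatrix}=R_{\vec m_1}(\pi),\quad \begin{pmatrix}0&\omega^{5/4}\\\omega^{1/4}&0\end{pmatrix}=R_{\vec m_2}(\pi),\quad \begin{pmatrix}0&\omega^{1/4}\\\omega^{5/4}&0\end{pmatrix}=R_{\vec m_3}(\pi),$$ where $\omega=e^{2\pi i/3}$ and $\omega^{t}=e^{2\pi i t/3}$ for real $t$. They are the six rotations of the Bloch sphere that leave invariant the equilateral triangle with vertices $\vec m_1,\vec m_2,\vec m_3$.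
   Context: The qubit trine POVM on $\mathbb C^2$ (basis $|0\rangle,|1\rangle$) is $\{\frac23|\phi_i\rangle\langle\phi_i|\}_{i=1}^3$ with $|\phi_i\rangle=\frac1{\sqrt2}(|0\rangle+\omega^{i-1}|1\rangle)$, $\omega=e^{2\pi i/3}$. Let $\vec m_i\in\mathbb R^3$ be the Bloch vector of $|\phi_i\rangle$, i.e. $|\phi_i\rangle\langle\phi_i|=\frac12(\mathbb 1+\vec m_i\cdot\vec\sigma)$, with $\vec\sigma$ the vector of Pauli matrices. For a unit vector $\vec n\in\mathbb R^3$, $R_{\vec n}(\theta)=e^{-i\frac\theta2\vec n\cdot\vec\sigma}$, which acts on the Bloch sphere as the rotation by angle $\theta$ around $\vec n$; $\vec e_z=(0,0,1)$. A (minimal) Naimark extension of the trine POVM is the rank-one projective measurement $\{|\varphi_i\rangle\langle\varphi_i|\}_{i=1}^3$ on $\mathbb C^3$ (orthonormal basis $|1\rangle,|2\rangle,|3\rangle$) with $|\varphi_i\rangle=\frac1{\sqrt3}(|1\rangle+\omega^{i-1}|2\rangle+\omega^{-(i-1)}|3\rangle)$, where $\mathbb C^2$ is embedded in $\mathbb C^3$ as the span of the first two basis vectors. A POVM-incoherent unitary of the trine POVM is the upper-left $2\times2$ block of a unitary $U'$ on $\mathbb C^3$ such that (i) for each $i$ there is $j$ with $U'|\varphi_i\rangle\propto|\varphi_j\rangle$, and (ii) $U'$ maps the span of the first two basis vectors of $\mathbb C^3$ into itself. *)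

(* Defs.v *)
From HB Require Import structures.
From mathcomp Require Import all_boot all_order all_algebra.
From mathcomp Require Import complex.
From mathcomp Require Import all_classical all_reals all_analysis ring.
Export numFieldNormedType.Exports.

Set Implicit Arguments.
Unset Strict Implicit.
Unset Printing Implicit Defensive.

Import Order.TTheory GRing.Theory Num.Theory.

Local Open Scope ring_scope.
Local Open Scope classical_set_scope.
Local Open Scope complex_scope.
Local Open Scope sesquilinear_scope.

(* e^A = \sum_k A^k / k!, the limit being taken in the normed space of
   matrices (sup norm). *)
Definition expmx (K : numFieldType) (n : nat) (A : 'M[K]_n.+1) : 'M[K]_n.+1 :=
  limn (series (fun k : nat => (k`!%:R)^-1 *: A ^+ k)).

Definition mx2 (T : Type) (a b c d : T) : 'M[T]_2 :=
  \matrix_(i, j) if i == ord0 then (if j == ord0 then a else b)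
                 else (if j == ord0 then c else d).

Section Qubit.
Variable R : realType.
Implicit Types (n r : 'cV[R]_3) (t x : R).

Definition expi x : R[i] := cos x +i* sin x.

Definition omega_pow t : R[i] := expi (2 * pi * t / 3).
Definition omega : R[i] := expi (2 * pi / 3).

Definition pauli : seq 'M[R[i]]_2 :=
  [:: mx2 0 1 1 0; mx2 0 (- 'i%C) 'i%C 0; mx2 1 0 0 (- 1)].

Definition dot_sigma n : 'M[R[i]]_2 :=
  \sum_(a < 3) (n a 0)%:C *: pauli`_a.

Definition bloch_state r : 'M[R[i]]_2 := 2^-1 *: (1%:M + dot_sigma r).

Definition qubit_rot n (theta : R) : 'M[R[i]]_2 :=
  expmx (- ('i%C * (theta / 2)%:C) *: dot_sigma n).

Definition e_z : 'cV[R]_3 := delta_mx ord_max 0.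

Definition ketbra (d : nat) (phi : 'cV[R[i]]_d) : 'M[R[i]]_d := phi *m phi ^t*.

(* The index i : 'I_3 takes the values 0, 1, 2, so that omega ^+ i is the
   usual omega^(i-1) for i = 1, 2, 3. *)
Definition trine_ket (i : 'I_3) : 'cV[R[i]]_2 :=
  (Num.sqrt 2)^-1%:C *: \col_(k < 2) [:: 1; omega ^+ i]`_k.

Definition naimark_ket (i : 'I_3) : 'cV[R[i]]_(2 + 1) :=
  (Num.sqrt 3)^-1%:C *: \col_(k < 2 + 1) [:: 1; omega ^+ i; omega ^- i]`_k.

(* C^d sits in C^(d+e) as the span of the first d basis vectors; phi is meant
   to be an orthonormal basis of C^(d+e). *)
Definition POVM_incoherent_unitary (d e N : nat)
    (phi : 'I_N -> 'cV[R[i]]_(d + e)) (V : 'M[R[i]]_d) : Prop :=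
  exists U : 'M[R[i]]_(d + e),
    [/\ U \is unitarymx,
        forall i, exists j, exists c : R[i], U *m phi i = c *: phi j,
        forall u : 'cV[R[i]]_d, exists w : 'cV[R[i]]_d,
          U *m col_mx u 0 = col_mx w 0
      & V = ulsubmx U].

Definition trine_incoherent_unitary : 'M[R[i]]_2 -> Prop :=
  POVM_incoherent_unitary naimark_ket.

Definition six_unitaries : seq 'M[R[i]]_2 :=
  [:: mx2 1 0 0 1;
      mx2 (omega_pow (- (1 / 2))) 0 0 (omega_pow (1 / 2));
      mx2 omega^* 0 0 omega;
      mx2 0 (- 'i%C) (- 'i%C) 0;
      mx2 0 (omega_pow (5 / 4)) (omega_pow (1 / 4)) 0;
      mx2 0 (omega_pow (1 / 4)) (omega_pow (5 / 4)) 0].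

Definition bloch_action (U : 'M[R[i]]_2) (Q : 'M[R]_3) : Prop :=
  forall r, U *m bloch_state r *m U ^t* = bloch_state (Q *m r).

Definition is_rotation (Q : 'M[R]_3) : Prop := Q *m Q^T = 1%:M /\ \det Q = 1.

(* The norm `|_| of the library on matrices is the sup norm. *)
Definition euclidean_norm r : R := Num.sqrt (\sum_(a < 3) r a 0 ^+ 2).

Definition triangle (m : 'I_3 -> 'cV[R]_3) : set 'cV[R]_3 :=
  [set p | exists w : 'I_3 -> R,
     [/\ forall i, 0 <= w i, \sum_i w i = 1 & p = \sum_i w i *: m i]].

Definition equilateral (m : 'I_3 -> 'cV[R]_3) : Prop :=
  exists2 l : R, 0 < l &
    forall i j, i != j -> euclidean_norm (m i - m j) = l.

Definition leaves_invariant (Q : 'M[R]_3) (A : set 'cV[R]_3) : Prop :=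
  [set Q *m p | p in A] = A.

Lemma realV (n : nat) : (n%:R^-1 : R)%:C = n%:R^-1.
Proof. exact: etrans (fmorphV (real_complex R) _) (congr1 _ (rmorph_nat _ _)). Qed.

Lemma naimark_ket_block i :
  ulsubmx (ketbra (naimark_ket i)) = (2 / 3) *: ketbra (trine_ket i).
Proof.
apply/matrixP => a b; rewrite !mxE !big_ord1 !mxE.
have s2 : (Num.sqrt 2 : R)^-1 * (Num.sqrt 2)^-1 = 2^-1.
  by rewrite -invfM -expr2 sqr_sqrtr.
have s3 : (Num.sqrt 3 : R)^-1 * (Num.sqrt 3)^-1 = 3^-1.
  by rewrite -invfM -expr2 sqr_sqrtr.
have K (u v : R[i]) (c : R) :
    (c%:C * u) * Num.conj (c%:C * v) = (c * c)%:C * (u * Num.conj v).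
  have cc : Num.conj c%:C = c%:C.
    by apply/eqP; rewrite eq_complex /= oppr0 !eqxx.
  have -> : Num.conj (c%:C * v) = c%:C * Num.conj v.
    by rewrite rmorphM; congr (_ * _); exact: cc.
  by rewrite rmorphM /= mulrACA.
have E (x y : R[i]) (c : 'I_2) : [:: 1; x; y]`_(lshift 1 c) = [:: 1; x]`_c.
  by case: c => [[|[|]]].
rewrite !E !K s2 s3 [RHS]mulrA; congr (_ * _).
by rewrite !realV mulrAC divff ?mul1r // pnatr_eq0.
Qed.

Lemma conj_omegaX k : omega ^+ k * Num.conj (omega ^+ k) = 1.
Proof.
rewrite rmorphXn -exprMn /= /conjc /omega /expi /=.
set c := cos _; set s := sin _.
have -> : (c +i* s) * (c +i* - s) = 1.
  apply/eqP; rewrite eq_complex /=; apply/andP; split; apply/eqP.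
    by rewrite mulrN opprK -!expr2 cos2Dsin2.
  by rewrite mulrN mulrC addNr.
by rewrite expr1n.
Qed.

(* The Bloch vectors of the trine kets exist. *)
Lemma trine_bloch_vector i :
  exists r : 'cV[R]_3, ketbra (trine_ket i) = bloch_state r.
Proof.
have zz := conj_omegaX i.
pose z := omega ^+ i.
exists (\col_k [:: complex.Re z; complex.Im z; 0]`_k).
rewrite /bloch_state /dot_sigma !big_ord_recl big_ord0.
have s2 : (Num.sqrt 2 : R)^-1 * (Num.sqrt 2)^-1 = 2^-1.
  by rewrite -invfM -expr2 sqr_sqrtr.
have K (u v : R[i]) (c : R) :
    (c%:C * u) * Num.conj (c%:C * v) = (c * c)%:C * (u * Num.conj v).
  have cc : Num.conj c%:C = c%:C.
    by apply/eqP; rewrite eq_complex /= oppr0 !eqxx.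
  have -> : Num.conj (c%:C * v) = c%:C * Num.conj v.
    by rewrite rmorphM; congr (_ * _); exact: cc.
  by rewrite rmorphM /= mulrACA.
apply/matrixP => a b; rewrite !mxE big_ord1 !mxE K s2 realV; congr (_ * _).
move: zz; rewrite -/z; case: z => x y zz.
by case: a b => [[|[|//]] pa] [[|[|//]] pb]; rewrite /= ?mxE /= ?zz;
  rewrite /conjc; apply/eqP; rewrite eq_complex /=; apply/andP; split; apply/eqP;
  rewrite /=; ring.
Qed.

End Qubit.

(* Main.v *)
(** A block-diagonal unitary on C^2 + C that sends Naimark kets to multiples of
    Naimark kets has its scalar block D determined up to phase, and the third
    coordinate then fixes every factor: W (1, w^i) = D w^(j(i)-i) (1, w^j(i)).
    Two distinct images j(0), j(1) solve for W, with j(1) - j(0) = 1 or -1 giving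
    a phase times diag(1, w^s) or antidiag(1, w^s), where s = j(0).

    The rotations are computed from exp(-i t S) = cos t - i sin t S, valid for
    S^2 = 1 by comparing power series.  On the equator of the Bloch sphere,
    identified with the unit circle of C, the six unitaries act as z |-> w^s z
    and z |-> w^s z^*.  The vertices are the only points of the triangle on the
    unit sphere, so a rotation preserving the triangle permutes them, and a
    rotation is determined by two of their images. *)

Require Import Defs.
From mathcomp Require Import all_boot all_order all_algebra.
From mathcomp Require Import complex.
From mathcomp Require Import all_classical all_reals all_analysis.
From mathcomp Require Import ring lra.

Set Implicit Arguments.
Unset Strict Implicit.
Unset Printing Implicit Defensive.

Import Order.TTheory GRing.Theory Num.Theory.
Local Open Scope ring_scope.

(** * Phases of modulus one and the cube root of unity [omega] *)

Section Phases.
Variable R : realType.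
Local Open Scope complex_scope.
Implicit Types x y : R.
Notation w := (omega R).

Lemma expiD x y : expi (x + y) = expi x * expi y.
Proof. by apply/eqP; rewrite eq_complex /= cosD sinD addrC [sin x * _ + _]addrC !eqxx. Qed.

Lemma expi0 : expi (0 : R) = 1.
Proof. by apply/eqP; rewrite eq_complex /= cos0 sin0 !eqxx. Qed.

Lemma expiN x : expi (- x) = (expi x)^-1.
Proof.
have e : expi x * expi (- x) = 1 by rewrite -expiD subrr expi0.
by apply: (mulfI (x := expi x)); rewrite ?e ?divff //; apply/eqP => z;
  move/eqP: e; rewrite z mul0r eq_sym oner_eq0.
Qed.

Lemma expiMn x n : expi (x *+ n) = expi x ^+ n.
Proof. by elim: n => [|n ih]; rewrite ?expi0 // mulrS expiD ih exprS. Qed.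

Lemma norm_expi x : `|expi x| = 1.
Proof. by rewrite normc_def /= cos2Dsin2 sqrtr1. Qed.

Lemma expi_pihalf : expi (pi / 2) = 'i%C :> R[i].
Proof. by rewrite /expi cos_pihalf sin_pihalf. Qed.

Lemma omega_powD (s t : R) : omega_pow (s + t) = omega_pow s * omega_pow t.
Proof. by rewrite -expiD /omega_pow; congr expi; field. Qed.

Lemma omega_pow_nat n : omega_pow (n%:R : R) = w ^+ n.
Proof. by rewrite /omega -expiMn /omega_pow; congr expi; rewrite -mulr_natr; field. Qed.

Lemma norm_omega_pow (t : R) : `|omega_pow t| = 1.
Proof. exact: norm_expi. Qed.

Lemma omega_pow_3quarter : omega_pow (3 / 4 : R) = 'i%C.
Proof. by rewrite -expi_pihalf /omega_pow; congr expi; field. Qed.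

Lemma omega_powN (t : R) : omega_pow (- t) = (omega_pow t)^-1.
Proof. by rewrite -expiN /omega_pow; congr expi; field. Qed.

(** Puts [-i] among the powers of [omega], so that entries of the half-turns can be compared by
    adding exponents. *)
Lemma oppi_omega_pow : - 'i%C = omega_pow (- (3 / 4)) :> R[i].
Proof.
have i0 : 'i%C != 0 :> R[i] by rewrite eq_complex /= oner_eq0 andbF.
rewrite omega_powN omega_pow_3quarter; apply: (mulfI i0).
by rewrite mulrN -expr2 sqr_i opprK divff.
Qed.

Lemma omega3 : w ^+ 3 = 1.
Proof.
have e : (2 * pi / 3) *+ 3 = pi *+ 2 :> R.
  by rewrite -[LHS]mulr_natr -[RHS]mulr_natr; field.
rewrite /omega -expiMn e.
by rewrite /expi cos2pi sin2pi.
Qed.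

Lemma omega_powD3 (t : R) : omega_pow (t + 3) = omega_pow t.
Proof. by rewrite omega_powD omega_pow_nat omega3 mulr1. Qed.

Lemma norm_omega : `|w| = 1.
Proof. exact: norm_expi. Qed.

Lemma omega_neq0 : w != 0.
Proof. by rewrite -normr_eq0 norm_omega oner_eq0. Qed.

Lemma Im_omega_gt0 : 0 < complex.Im w.
Proof.
have p0 := pi_gt0 R.
by apply: sin_gt0_pi; apply/andP; split; lra.
Qed.

Lemma omega_neq1 : w != 1.
Proof. by apply/eqP => e; have := Im_omega_gt0; rewrite e ltxx. Qed.

Lemma omega_sum : 1 + w + w ^+ 2 = 0.
Proof.
(* Multiplication by [w - 1] turns the sum into [w^3 - 1]. *)
apply: (mulfI (x := w - 1)); first by rewrite subr_eq0 omega_neq1.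
by rewrite mulr0 -[RHS](subrr 1) -{3}omega3; ring.
Qed.

(** The order of [w] divides 3 and is not 1. *)
Lemma omega_prim : 3.-primitive_root w.
Proof.
have [//|n nP dn] := @prim_order_exists _ 3 _ _ omega3.
case: n nP dn => [|[|[|[|n]]]] // nP dn.
by move: (prim_expr_order nP) omega_neq1; rewrite expr1 => ->; rewrite eqxx.
Qed.

Lemma conj_unit (z : R[i]) : `|z| = 1 -> z^* = z^-1.
Proof. by move=> z1; rewrite invC_norm z1 expr1n invr1 mul1r. Qed.

Lemma conj_omega : w^* = w ^+ 2.
Proof.
rewrite conj_unit ?norm_omega //.
by apply: (mulfI omega_neq0); rewrite -exprS omega3 divff ?omega_neq0.
Qed.

(** This is the real part of [1 + w + w^* = 0]. *)
Lemma Re_omega : complex.Re w = - 2^-1.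
Proof.
have := omega_sum; rewrite -conj_omega => /eqP; rewrite eq_complex /= => /andP[/eqP e _].
by move: e; rewrite -/(complex.Re w); lra.
Qed.

Lemma Im_omega2 : complex.Im w ^+ 2 = 3 / 4.
Proof.
have := cos2Dsin2 (2 * pi / 3 : R).
rewrite -[cos _]/(complex.Re w) -[sin _]/(complex.Im w) Re_omega; lra.
Qed.

End Phases.

(** * The exponential of a multiple of an involution *)

Section Exponential.
Variable R : realType.
Local Open Scope complex_scope.
Local Open Scope classical_set_scope.
Implicit Types x y : R.

Lemma cvg_real_complex (u : R^nat) (l : R) :
  u @ \oo --> l -> (fun n => (u n)%:C) @ \oo --> (l%:C : (R[i] : numFieldType)).
Proof.
move=> ul.
apply/(@cvgrPdist_lt (R[i] : numFieldType) (R[i] : numFieldType)) => e.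
(* A positive tolerance in [R[i]] has zero imaginary part, so its real part serves as the tolerance
   in [R]. *)
rewrite ltcE /= => /andP[/eqP ie re].
move/cvgrPdist_lt: ul => /(_ _ re); apply: filterS => n h.
rewrite -raddfB /= normc_def /= expr0n addr0 sqrtr_sqr.
by rewrite ltcE /= ie eqxx.
Qed.

(** The matrix [T = -i S] squares to [-1], so in the series of [t T] the even powers carry the
    cosine coefficients and the odd powers the sine coefficients. *)
Lemma expmx_involution n (S : 'M[R[i]]_n.+1) (t : R) : S *m S = 1%:M ->
  expmx (- ('i%C * t%:C) *: S) = (cos t)%:C *: 1%:M + (- ('i%C * (sin t)%:C)) *: S.
Proof.
move=> SS.
pose T := - 'i%C *: S.
have TT : T *m T = - 1%:M.
  by rewrite -scalemxAl -scalemxAr scalerA SS mulrNN -expr2 sqr_i scaleN1r.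
have -> : - ('i%C * t%:C) *: S = t%:C *: T by rewrite scalerA mulrN mulrC.
have -> : - ('i%C * (sin t)%:C) *: S = (sin t)%:C *: T by rewrite scalerA mulrN mulrC.
have Tpow k : T ^+ k.*2 = (-1) ^+ k *: (1%:M : 'M[R[i]]_n.+1).
  elim: k => [|k ih]; first by rewrite expr0 scale1r.
  rewrite doubleS 2!exprSr ih exprSr -mulrA.
  by rewrite [T * T]TT -scalerAl mul1r mulrN1 scalerN -scaleNr.
have Tcoef k : (k`!%:R)^-1 *: (t%:C *: T) ^+ k =
    (cos_coeff t k)%:C *: (1%:M : 'M[R[i]]_n.+1) + (sin_coeff t k)%:C *: T.
  have cE (a : R) b : (b`!%:R)^-1 * a%:C = (a / b`!%:R)%:C.
    by rewrite mulrC rmorphM fmorphV /= rmorph_nat.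
  rewrite exprZn -(rmorphXn (real_complex R)) scalerA /= cE.
  rewrite -[k]odd_double_half; case: (odd k); rewrite ?add1n ?add0n.
    rewrite cos_coeff_odd scale0r add0r -sin_coeff'E [T ^+ _.+1]exprSr Tpow.
    rewrite -[_ * T]scalerAl mul1r scalerA /sin_coeff'; congr (_ *: _).
    have -> : (-1) ^+ k./2 = ((-1) ^+ k./2)%:C :> R[i] by rewrite rmorphXn rmorphN1.
    by rewrite -rmorphM; congr (_%:C); rewrite mulrC mulrA.
  rewrite sin_coeff_even scale0r addr0 -cos_coeff'E Tpow scalerA /cos_coeff'.
  have -> : (-1) ^+ k./2 = ((-1) ^+ k./2)%:C :> R[i] by rewrite rmorphXn rmorphN1.
  by rewrite -rmorphM; congr ((_%:C) *: _); rewrite mulrC mulrA.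
rewrite /expmx; apply: cvg_lim; first exact: norm_hausdorff.
(* Each partial sum already splits into a real cosine part and a real sine part, whose limits are
   known in [R]. *)
rewrite (_ : series _ =
    fun n => (series (cos_coeff t) n)%:C *: 1%:M + (series (sin_coeff t) n)%:C *: T).
  apply: cvgD; apply: cvgZr_tmp; apply: cvg_real_complex.
    by rewrite cos.unlock; exact: is_cvg_series_cos_coeff.
  by rewrite sin.unlock; exact: is_cvg_series_sin_coeff.
apply/funext => N; rewrite /series /= !raddf_sum !scaler_suml -big_split /=.
by apply: eq_bigr => k _; exact: Tcoef.
Qed.

End Exponential.

(** * Entrywise calculus for 2 by 2 matrices and vectors of length 3 *)

Section TwoByTwo.
Variable A : comNzRingType.
Implicit Types a b c d : A.

Lemma mx2_eta (M : 'M[A]_2) : M = mx2 (M 0 0) (M 0 1) (M 1 0) (M 1 1).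
Proof.
by apply/matrixP => -[[|[|//]] ip] [[|[|//]] jp]; rewrite mxE /=; congr (M _ _); apply: val_inj.
Qed.

Lemma mx2_inj a b c d a' b' c' d' : mx2 a b c d = mx2 a' b' c' d' ->
  [/\ a = a', b = b', c = c' & d = d'].
Proof.
move/matrixP => e; move: (e 0 0) (e 0 1) (e 1 0) (e 1 1).
by rewrite !mxE /= => -> -> -> ->.
Qed.

Lemma mulmx2 a b c d a' b' c' d' : mx2 a b c d *m mx2 a' b' c' d' =
  mx2 (a * a' + b * c') (a * b' + b * d') (c * a' + d * c') (c * b' + d * d').
Proof. by rewrite [LHS]mx2_eta !mxE !big_ord_recl !big_ord0 !mxE /= !addr0. Qed.

Lemma addmx2 a b c d a' b' c' d' : mx2 a b c d + mx2 a' b' c' d' =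
  mx2 (a + a') (b + b') (c + c') (d + d').
Proof. by rewrite [LHS]mx2_eta !mxE /=. Qed.

Lemma scalemx2 e a b c d : e *: mx2 a b c d = mx2 (e * a) (e * b) (e * c) (e * d).
Proof. by rewrite [LHS]mx2_eta !mxE /=. Qed.

Lemma scalar_mx2 a : a%:M = mx2 a 0 0 a.
Proof. by rewrite [LHS]mx2_eta !mxE /=. Qed.

Lemma det_mx22 (M : 'M[A]_2) :
  \det M = M 0 0 * M 1 1 - M 0 1 * M 1 0.
Proof.
rewrite (expand_det_row _ 0) !big_ord_recl big_ord0 /cofactor !det_mx11 !mxE /=.
rewrite addr0 /= !expr0 expr1 !mul1r mulN1r mulrN.
by congr (_ * M _ _ - M _ _ * M _ _); apply: val_inj.
Qed.

Definition col3 a b c : 'cV[A]_3 := \col_i [:: a; b; c]`_i.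

Lemma col3_eta (v : 'cV[A]_3) : v = col3 (v 0 0) (v 1 0) (v ord_max 0).
Proof.
apply/colP => i; rewrite mxE.
by case: i => [[|[|[|//]]] p]; congr (v _ _); apply/val_inj.
Qed.

Lemma col3_inj a b c a' b' c' : col3 a b c = col3 a' b' c' -> [/\ a = a', b = b' & c = c'].
Proof.
by move/colP => e; move: (e 0) (e 1) (e ord_max); rewrite !mxE /= => -> -> ->.
Qed.

End TwoByTwo.

(** * Bloch vectors and closed forms of qubit rotations *)

Section BlochBall.
Variable R : realType.
Local Open Scope complex_scope.
Local Open Scope sesquilinear_scope.
Notation w := (omega R).

Lemma adjmx2 (a b c d : R[i]) : (mx2 a b c d) ^t* = mx2 a^* c^* b^* d^*.
Proof. by rewrite [LHS]mx2_eta !mxE. Qed.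

Lemma dot_sigmaE (a b c : R) :
  dot_sigma (col3 a b c) = mx2 c%:C (a -i* b) (a +i* b) (- c%:C).
Proof.
rewrite /dot_sigma !big_ord_recl big_ord0 /pauli /= !scalemx2.
rewrite addr0 !addmx2 !mxE /=.
by congr mx2; apply/eqP; rewrite eq_complex /=; apply/andP; split; apply/eqP; ring.
Qed.

Lemma bloch_stateE (a b c : R) :
  bloch_state (col3 a b c) = 2^-1 *: mx2 (1 + c%:C) (a -i* b) (a +i* b) (1 - c%:C).
Proof. by rewrite /bloch_state dot_sigmaE scalar_mx2 addmx2 !add0r. Qed.

(** The lower-left entry recovers the first two coordinates and the upper-left entry the third. *)
Lemma bloch_state_inj : injective (@bloch_state R).
Proof.
move=> u v; rewrite (col3_eta u) (col3_eta v) !bloch_stateE.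
move/scalerI => e.
have /e/mx2_inj[e1 _ [-> ->] _] : (2^-1 : R[i]) != 0 by rewrite invr_neq0 ?pnatr_eq0.
by move/addrI: e1 => [->].
Qed.

Definition equator (z : R[i]) : 'cV[R]_3 := col3 (complex.Re z) (complex.Im z) 0.

(** By injectivity of [bloch_state], this pins down the vectors [m] assumed in the theorem. *)
Lemma trine_bloch (i : 'I_3) (r : 'cV[R]_3) :
  ketbra (trine_ket R i) = bloch_state r -> r = equator (w ^+ i).
Proof.
suff -> : ketbra (trine_ket R i) = bloch_state (equator (w ^+ i)).
  by move/bloch_state_inj.
have n1 := conj_omegaX R i.
have s2 : ((Num.sqrt 2)^-1)%:C * ((Num.sqrt 2)^-1)%:C = 2^-1 :> R[i].
  by rewrite -rmorphM -invfM -expr2 sqr_sqrtr ?ler0n //; exact: (Defs.realV R 2).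
have cc (u v : R[i]) (c : R) : c%:C * u * Num.conj (c%:C * v) = (c%:C * c%:C) * (u * Num.conj v).
  rewrite rmorphM mulrACA; congr (_ * _ * _).
  by apply/eqP; rewrite eq_complex /= oppr0 !eqxx.
rewrite bloch_stateE [LHS]mx2_eta !mxE !big_ord1 !mxE /= !cc s2 n1.
rewrite scalemx2 subr0 addr0 !rmorph1 !mulr1 mul1r.
by case: (w ^+ i).
Qed.

(** The Pauli matrices anticommute and square to 1, so [dot_sigma] of a unit vector is an
    involution. *)
Lemma qubit_rotE (a b c t : R) : a ^+ 2 + b ^+ 2 + c ^+ 2 = 1 ->
  qubit_rot (col3 a b c) t = (cos (t / 2))%:C *: 1%:M
    + (- ('i%C * (sin (t / 2))%:C)) *: dot_sigma (col3 a b c).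
Proof.
move=> n1; rewrite /qubit_rot expmx_involution // dot_sigmaE mulmx2 scalar_mx2.
congr mx2; apply/eqP; rewrite eq_complex /= -?n1; apply/andP; split; apply/eqP; ring.
Qed.

Lemma rot_z (t : R) : qubit_rot (e_z R) t = mx2 (expi (- (t / 2))) 0 0 (expi (t / 2)).
Proof.
have -> : e_z R = col3 0 0 1 by rewrite (col3_eta (e_z R)) !mxE.
rewrite qubit_rotE ?expr0n ?expr1n ?add0r // dot_sigmaE scalar_mx2 !scalemx2 addmx2.
by congr mx2; apply/eqP; rewrite eq_complex /= ?cosN ?sinN; apply/andP; split; apply/eqP; ring.
Qed.

Lemma sqr_Re_Im (z : R[i]) : `|z| = 1 -> complex.Re z ^+ 2 + complex.Im z ^+ 2 = 1.
Proof.
move=> z1; have := sqr_normc z; rewrite z1 expr1n => /eqP.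
by case: z z1 => x y _; rewrite eq_complex /= => /andP[/eqP e _]; rewrite e; ring.
Qed.

(** The half-angle is [pi / 2]: the cosine term drops out and [-i] times [dot_sigma] remains. *)
Lemma rot_equator_pi (z : R[i]) : `|z| = 1 ->
  qubit_rot (equator z) pi = mx2 0 (- 'i%C * z^-1) (- 'i%C * z) 0.
Proof.
move=> z1; have zz := sqr_Re_Im z1.
rewrite -conj_unit // qubit_rotE ?zz ?expr0n ?addr0 //.
rewrite dot_sigmaE scalar_mx2 !scalemx2 addmx2 cos_pihalf sin_pihalf.
by case: z z1 zz => x y _ _; congr mx2; apply/eqP; rewrite eq_complex /=;
  apply/andP; split; apply/eqP; ring.
Qed.

End BlochBall.

(** * The six unitaries as a dihedral family up to phase *)

Section Dihedral.
Variable R : realType.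
Local Open Scope complex_scope.
Local Open Scope sesquilinear_scope.
Notation w := (omega R).

(** The nonzero entry of the first row is normalised to 1, which selects one representative of each
    class up to a scalar. *)
Definition dih (b : bool) (z : R[i]) : 'M[R[i]]_2 :=
  if b then mx2 0 1 z 0 else mx2 1 0 0 z.

(** The position of the zeros gives [b], the first row gives [p = q], and the second row then gives
    [z]. *)
Lemma dih_proj_inj (p q z z' : R[i]) b b' : p != 0 -> q != 0 ->
  p *: dih b z = q *: dih b' z' -> b = b' /\ z = z'.
Proof.
move=> p0 q0; case: b b' => -[] /=; rewrite !scalemx2 !mulr0 !mulr1;
  move=> /mx2_inj[] e1 e2 e3 e4; try by rewrite ?e1 ?e2 -?e1 -?e2 eqxx in p0 q0.
  by split=> //; rewrite e2 in e3; exact: (mulfI q0).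
by split=> //; rewrite e1 in e4; exact: (mulfI q0).
Qed.

(** Addition in ['I_3] is modulo 3, which powers of [w] respect; indices can thus be computed in
    Z/3. *)
Lemma omega_ord (i j : 'I_3) : w ^+ (i + j)%R = w ^+ i * w ^+ j.
Proof. by rewrite -exprD (prim_expr_mod (omega_prim R)). Qed.

Lemma omega_ordN (i : 'I_3) : w ^+ (- i)%R = (w ^+ i)^-1.
Proof.
have wi0 : w ^+ i != 0 by rewrite expf_neq0 ?omega_neq0.
by apply: (mulfI wi0); rewrite -omega_ord subrr divff.
Qed.

Lemma omega_ord_inj : injective (fun i : 'I_3 => w ^+ i).
Proof.
move=> i j /eqP; rewrite (eq_prim_root_expr (omega_prim R)) !modn_small ?ltn_ord // => /eqP.
exact: val_inj.
Qed.

Lemma norm_omegaX n : `|w ^+ n| = 1.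
Proof. by rewrite normrX norm_omega expr1n. Qed.

Lemma I3_neq (i j : 'I_3) : i != j -> j = i + 1 \/ j = i - 1.
Proof.
case: i j => -[|[|[|//]]] ip [[|[|[|//]]] jp] // _;
  by [left; apply: val_inj | right; apply: val_inj].
Qed.

(* [flip] and [turn] index the six unitaries as the elements of the dihedral
   group Z/2 x| Z/3: the k-th one is a phase times [dih (flip k) (w ^+ turn k)]. *)
Definition flip (k : 'I_6) : bool := (2 < k)%N.
Definition turn (k : 'I_6) : 'I_3 := [:: 0; 1; 2; 0; 2; 1]`_k.

Lemma flip_turn_inj k l : flip k = flip l -> turn k = turn l -> k = l.
Proof.
case: k l => -[|[|[|[|[|[|//]]]]]] kp [[|[|[|[|[|[|//]]]]]] lp] //= _ e;
  by [apply: val_inj | have := congr1 val e].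
Qed.

Lemma flip_turn_surj b (s : 'I_3) : exists k, flip k = b /\ turn k = s.
Proof.
by case: b s => -[[|[|[|//]]] sp];
  [exists (inord 3)|exists (inord 5)|exists (inord 4)
  |exists (inord 0)|exists (inord 1)|exists (inord 2)];
  rewrite /flip /turn inordK //; split=> //; apply: val_inj.
Qed.

(** The phase [p] is always the nonzero entry of the first row. *)
Lemma six_unitaries_dih (k : 'I_6) : exists2 p : R[i], `|p| = 1 &
  (six_unitaries R)`_k = p *: dih (flip k) (w ^+ turn k).
Proof.
have op1 (t : R) : omega_pow (t + 1) = omega_pow t * w.
  by rewrite omega_powD -[w]expr1 -omega_pow_nat.
case: k => -[|[|[|[|[|[|//]]]]]] kp; rewrite /flip /turn /=.
- by exists 1; rewrite ?normr1 // scale1r expr0.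
- exists (omega_pow (- (1 / 2))); rewrite ?norm_omega_pow // scalemx2 !mulr0 mulr1 expr1.
  by rewrite -op1; congr (mx2 _ _ _ (omega_pow _)); field.
- exists (w ^+ 2); first exact: norm_omegaX.
  rewrite scalemx2 !mulr0 mulr1; congr mx2; first exact: conj_omega.
  by rewrite -exprD (_ : _ + _ = 3 + 1)%N // exprD omega3 mul1r expr1.
- exists (- 'i%C); first by rewrite normrN -omega_pow_3quarter norm_omega_pow.
  by rewrite scalemx2 !mulr0 expr0 mulr1.
- exists (omega_pow (5 / 4)); rewrite ?norm_omega_pow // scalemx2 !mulr0 mulr1.
  congr mx2; transitivity (omega_pow (5 / 4) * w ^+ 2) => //.
  (* The exponents agree after one period: [1/4 + 3 = 5/4 + 2]. *)
  rewrite -[LHS]mulr1 -(omega3 R) -!omega_pow_nat -!omega_powD.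
  by congr omega_pow; field.
- exists (omega_pow (1 / 4)); rewrite ?norm_omega_pow // scalemx2 !mulr0 mulr1 expr1.
  by rewrite -op1; congr (mx2 _ _ (omega_pow _) _); field.
Qed.

(** * Classification of the incoherent unitaries *)

Definition ket2 (z : R[i]) : 'cV[R[i]]_2 := \col_(k < 2) [:: 1; z]`_k.

Lemma mulmx2_ket a b c d (z : R[i]) :
  mx2 a b c d *m ket2 z = \col_(k < 2) [:: a + b * z; c + d * z]`_k.
Proof.
apply/colP => k; rewrite !mxE !big_ord_recl big_ord0 !mxE /= addr0 !mulr1.
by case: k => [[|[|//]]].
Qed.

(** Splits the ket along C^2 + C, so that block matrices act on the two parts separately. *)
Lemma naimark_ketE (i : 'I_3) : naimark_ket R i =
  (Num.sqrt 3)^-1%:C *: col_mx (ket2 (w ^+ i)) (w ^- i)%:M.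
Proof.
congr (_ *: _); apply/colP => k; rewrite !mxE; case: splitP => j ->; rewrite !mxE //=.
  by case: j => [[|[|//]]].
by rewrite (ord1 j).
Qed.

Lemma dih_ket b (z u : R[i]) : u != 0 -> dih b z *m ket2 u =
  if b then u *: ket2 (z / u) else ket2 (z * u).
Proof.
move=> u0; case: b; rewrite mulmx2_ket; apply/colP => -[[|[|//]] kp]; rewrite !mxE /=.
all: by rewrite ?mul0r ?add0r ?addr0 ?mul1r ?mulr1 // mulrCA divff ?mulr1.
Qed.

Lemma dih_incoherent b (s : 'I_3) (c : R[i]) : `|c| = 1 ->
  trine_incoherent_unitary (c *: dih b (w ^+ s)).
Proof.
move=> c1; have c0 : c != 0 by rewrite -normr_eq0 c1 oner_eq0.
set z := w ^+ s; have z1 : `|z| = 1 by exact: norm_omegaX.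
have z0 : z != 0 by rewrite -normr_eq0 z1 oner_eq0.
(* The corner [c / z] is forced by the third coordinate: [c w^-(s+i)] without flip, and
   [c w^i w^-(s-i) = c w^(2i) / z] with flip, both equal to [(c / z) w^-i] because
   [w^(2i) = w^-i]. *)
exists (block_mx (c *: dih b z) 0 0 (c / z)%:M); split.
- apply/unitarymxP; rewrite tr_block_mx map_block_mx mulmx_block.
  rewrite !trmx0 !map_mx0 !mulmx0 !mul0mx !addr0 !add0r (@scalar_mx_block _ 2 1).
  congr block_mx; last first.
    rewrite tr_scalar_mx map_scalar_mx -scalar_mxM -[X in _ * X]/((c / z)^*).
    by rewrite conj_unit ?divff ?mulf_neq0 ?invr_eq0 // normf_div c1 z1 divr1.
  rewrite /dih; case: b; rewrite scalemx2 adjmx2 mulmx2 scalar_mx2 !mulr0 !mulr1.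
    rewrite !conjc0 !mulr0 !mul0r !addr0 !add0r.
    by rewrite !conj_unit ?normrM ?c1 ?z1 ?mulr1 // !divff ?mulf_neq0.
  rewrite !conjc0 !mulr0 !mul0r !addr0 !add0r.
  by rewrite !conj_unit ?normrM ?c1 ?z1 ?mulr1 // !divff ?mulf_neq0.
- move=> i; exists (if b then s - i else s + i).
  have u0 : w ^+ i != 0 by rewrite expf_neq0 ?omega_neq0.
  have uV : (w ^+ i)^-1 = w ^+ i * w ^+ i.
    by apply: (mulfI u0); rewrite divff // -expr2 -[RHS]exprS -exprM mulnC exprM omega3 expr1n.
  exists (if b then c * w ^+ i else c).
  rewrite !naimark_ketE -scalemxAr [RHS]scalerA [_ * _%:C]mulrC -scalerA; congr (_ *: _).
  rewrite mul_block_col !mul0mx addr0 add0r -scalemxAl dih_ket // -scalar_mxM scale_col_mx.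
  case: b; rewrite omega_ord ?omega_ordN ?scalerA; congr col_mx;
    rewrite scale_scalar_mx -/z; congr (_%:M); last by rewrite invfM mulrA.
  by rewrite {1}uV; field; rewrite u0 z0.
- by move=> u; eexists; rewrite mul_block_col !mulmx0 mul0mx !addr0.
- by rewrite block_mxKul.
Qed.

Lemma incoherent_dih (W : 'M[R[i]]_2) : trine_incoherent_unitary W ->
  exists b (s : 'I_3) (c : R[i]), `|c| = 1 /\ W = c *: dih b (w ^+ s).
Proof.
case=> U [/unitarymxP UU Uphi Uspan ->].
rewrite -(submxK U) block_mxKul in UU Uphi Uspan *.
move: (ulsubmx U) (ursubmx U) (dlsubmx U) (drsubmx U) UU Uphi Uspan.
move=> A B C D UU Uphi Uspan.
(* Invariance of the span, tested on basis vectors, kills the lower-left block. *)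
have C0 : C = 0.
  apply/matrixP => i j; have [v] := Uspan (delta_mx j 0).
  rewrite mul_block_col !mulmx0 !addr0 => /eq_col_mx[_ /matrixP/(_ i 0)].
  by rewrite -colE !mxE.
(* With [C = 0], the upper blocks of [U^* U = 1] read [A^* A = 1] and [A^* B = 0], so the square
   block [A] is unitary and [B] vanishes. *)
have := mulmx1C UU; rewrite C0 tr_block_mx map_block_mx mulmx_block.
rewrite trmx0 map_mx0 !mulmx0 !mul0mx !addr0 (@scalar_mx_block _ 2 1).
move=> /eq_block_mx[AA AB _ DD].
have B0 : B = 0 by rewrite -[B]mul1mx -(mulmx1C AA) -mulmxA AB mulmx0.
have {}DD : `|D 0 0| = 1.
  move: DD; rewrite B0 mulmx0 add0r => /matrixP/(_ 0 0).
  rewrite !mxE big_ord1 !mxE => e; apply/eqP.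
  by rewrite -(@pexpr_eq1 _ _ 2) ?normr_ge0 // normCKC; apply/eqP.
(* The third coordinate of [U phi_i = c phi_j] says [D w^-i = c w^-j], which fixes the factor
   [c]. *)
have key (i : 'I_3) : exists j : 'I_3,
    A *m ket2 (w ^+ i) = (D 0 0 * w ^+ (j - i)%R) *: ket2 (w ^+ j).
  have [j [c e]] := Uphi i; exists j; move: e.
  rewrite !naimark_ketE -scalemxAr [X in _ = X -> _]scalerA [_ * (_%:C)]mulrC.
  rewrite -[X in _ = X -> _]scalerA => /scalerI.
  have s3 : ((Num.sqrt 3)^-1)%:C != 0 :> R[i].
    by rewrite fmorph_eq0 invr_eq0 sqrtr_eq0 -ltNge ltr0n.
  move/(_ s3); rewrite C0 B0 mul_block_col !mul0mx addr0 add0r scale_col_mx.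
  case/eq_col_mx => -> /matrixP/(_ 0 0).
  rewrite !mxE big_ord1 !mxE !mulr1n => e; congr (_ *: _).
  have j0 : w ^+ j != 0 by rewrite expf_neq0 ?omega_neq0.
  have -> : c = D 0 0 * w ^- i * w ^+ j by rewrite e; field.
  by rewrite omega_ord omega_ordN; ring.
have [j0 k0] := key 0; have [j1 k1] := key 1.
move: k0 k1; rewrite subr0 expr0 expr1.
set d := D 0 0 in DD * => k0 k1.
have d0 : d != 0 by rewrite -normr_eq0 DD oner_eq0.
have w1 := omega_neq1 R.
have w1' : 1 - w != 0 by rewrite subr_eq0 eq_sym.
(* A is injective and the kets (1, 1) and (1, w) are not parallel. *)
have j01 : j0 != j1.
  apply/eqP => j01; have : (d * w ^+ (j1 - 1)%R) *: ket2 1 = (d * w ^+ j0) *: ket2 w.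
    rewrite -[ket2 1]mul1mx -[ket2 w]mul1mx -AA -!mulmxA k0 k1 -j01.
    by rewrite -!scalemxAr !scalerA mulrC.
  move/colP => e; move: (e 0) (e 1); rewrite !mxE /= !mulr1 => -> /eqP.
  by rewrite -subr_eq0 -{1}[d * _]mulr1 -mulrBr !mulf_eq0 (negPf d0) (negPf w1')
             expf_eq0 (negPf (omega_neq0 R)) andbF.
rewrite (mx2_eta A) in k0 k1 *; rewrite !mulmx2_ket in k0 k1.
set t := w ^+ (j1 - 1)%R in k1; move: k0 k1 => /colP k0 /colP k1.
move: (k0 0) (k0 1) (k1 0) (k1 1); rewrite !mxE /= !mulr1.
set x := A 0 0; set y := A 0 1; set u := A 1 0; set v := A 1 1.
move=> e00 e01 e10 e11.
have q0 : w ^+ j0 != 0 by rewrite expf_neq0 ?omega_neq0.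
(* Each row of [A] solves a Vandermonde system with nodes 1 and [w]. *)
have solve (a b p q : R[i]) : a + b = p -> a + b * w = q ->
    b = (p - q) / (1 - w) /\ a = (q - p * w) / (1 - w).
  by move=> <- <-; split; field.
have w3 := omega3 R; have ww : w^-1 = w ^+ 2.
  by apply: (mulfI (omega_neq0 R)); rewrite divff ?omega_neq0 // -exprS.
have [yE xE] := solve _ _ _ _ e00 e10; have [vE uE] := solve _ _ _ _ e01 e11.
rewrite /t in xE yE uE vE.
(* For [j1 = j0 + 1] the factor [t] is [w^j0], so the two first-row equations have equal right-hand
   sides and [y = 0]; in the second row they differ by the factor [w], so [u = 0]. *)
case: (I3_neq j01) yE xE vE uE => ->; rewrite ?addrK !omega_ord ?omega_ordN expr1.
  move=> yE xE vE uE; exists false, j0, (d * w ^+ j0).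
  split; first by rewrite normrM DD norm_omegaX mulr1.
  rewrite /= scalemx2 !mulr0 mulr1 yE xE vE uE.
  by congr mx2; field.
move=> yE xE vE uE; exists true, j0, (d * w ^+ j0).
split; first by rewrite normrM DD norm_omegaX mulr1.
(* For [j1 = j0 - 1], [w^-2 = w] makes the second right-hand side of the first row [w] times the
   first, so [x = 0]. *)
have wVV : w ^+ j0 / w / w = w ^+ j0 * w.
  by rewrite -mulrA ww -exprD exprS w3 mulr1.
rewrite wVV in yE xE vE uE.
rewrite /= scalemx2 !mulr0 mulr1 yE xE vE uE.
by congr mx2; field; rewrite w1' ?omega_neq0.
Qed.


End Dihedral.

(** * Rotations of the Bloch sphere induced by the unitaries *)

Section Rotations.
Variable R : realType.
Local Open Scope complex_scope.
Local Open Scope sesquilinear_scope.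
Notation w := (omega R).
Implicit Types (z u : R[i]) (S T : 'M[R]_3).

(** For [|z| = 1]: the rotation about the z axis by the argument of [z], or a half-turn about an
    axis in the equatorial plane. The last entry [e] compensates the reflection of that plane and
    keeps the determinant at 1. *)
Definition dih_rot (b : bool) z : 'M[R]_3 :=
  let x := complex.Re z in let y := complex.Im z in let e := (-1) ^+ b in
  \matrix_(i, j) (nth [::] [:: [:: x; - (e * y); 0]; [:: y; e * x; 0]; [:: 0; 0; e]] i)`_j.

Lemma dih_rot_col3 b z (p q r : R) : dih_rot b z *m col3 p q r =
  let x := complex.Re z in let y := complex.Im z in let e := (-1) ^+ b in
  col3 (x * p - e * y * q) (y * p + e * x * q) (e * r).
Proof.
rewrite [LHS]col3_eta !mxE !big_ord_recl !big_ord0 !mxE /=.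
by congr col3; ring.
Qed.

Lemma dih_rot_equator b z u :
  dih_rot b z *m equator u = equator (z * (if b then u^* else u)).
Proof.
rewrite dih_rot_col3; case: z u b => x y [p q] [] /=;
  by congr col3; rewrite ?expr1 ?expr0 /=; ring.
Qed.

(** The phase [c] cancels under conjugation, and the off-diagonal entries pick up [z] and its
    conjugate. *)
Lemma dih_bloch_action b z c : `|c| = 1 -> `|z| = 1 ->
  bloch_action (c *: dih b z) (dih_rot b z).
Proof.
move=> c1 z1 r; rewrite (col3_eta r); move: (r 0 0) (r 1 0) (r ord_max 0) => p q s.
have c0 : c != 0 by rewrite -normr_eq0 c1 oner_eq0.
have cV : conjc c = c^-1 by exact: conj_unit.
have czV : conjc (c * z) = c^-1 * conjc z by rewrite rmorphM /= cV.
have k1 a : c * a / c = a by rewrite mulrAC divff ?mul1r.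
have k2 a a' : c * a * (c^-1 * a') = a * a' by rewrite mulrACA divff ?mul1r.
have zz : z * conjc z = 1 by rewrite -sqr_normc z1 expr1n.
rewrite dih_rot_col3 !bloch_stateE -scalemxAr -scalemxAl; congr (_ *: _).
case: b; rewrite /dih scalemx2 adjmx2 !mulmx2 !mulr0 !mulr1 conjc0.
(* The assumption [|z| = 1] serves to reach this form; the rest is an identity of real and imaginary
   parts valid for every [z]. *)
- transitivity (mx2 (1 - s%:C) ((p +i* q) * conjc z) (z * (p -i* q)) (1 + s%:C)).
    rewrite czV cV; congr mx2; rewrite ?mulr0 ?mul0r ?addr0 ?add0r ?k1 ?k2 //.
      by rewrite -[c * z * _]mulrA k1.
    by rewrite -[c * z * _]mulrA k2 mulrAC zz mul1r.
  by case: (z) => x y; congr mx2; apply/eqP; rewrite eq_complex /=;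
    apply/andP; split; apply/eqP; ring.
- transitivity (mx2 (1 + s%:C) ((p -i* q) * conjc z) (z * (p +i* q)) (1 - s%:C)).
    rewrite czV cV; congr mx2; rewrite ?mulr0 ?mul0r ?addr0 ?add0r ?k1 ?k2 //.
      by rewrite -[c * z * _]mulrA k1.
    by rewrite -[c * z * _]mulrA k2 mulrAC zz mul1r.
  by case: (z) => x y; congr mx2; apply/eqP; rewrite eq_complex /=;
    apply/andP; split; apply/eqP; ring.
Qed.

Lemma dih_rot_rotation b z : `|z| = 1 -> is_rotation (dih_rot b z).
Proof.
move/sqr_Re_Im => z1; split.
  apply/matrixP => i j; rewrite !mxE !big_ord_recl !big_ord0 !mxE /=.
  case: i j => [[|[|[|//]]] ip] [[|[|[|//]]] jp]; rewrite /= ?mulr1n ?mulr0n;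
    case: b; rewrite ?expr1 ?expr0; first [by ring | by apply: (etrans _ z1); ring].
rewrite (expand_det_row _ ord_max) !big_ord_recl big_ord0 /cofactor !det_mx22 !mxE /=.
rewrite -[RHS]z1; case: b; rewrite ?expr1 ?expr0 /=; ring.
Qed.

Lemma dih_rot_inj b b' z z' : dih_rot b z = dih_rot b' z' -> b = b' /\ z = z'.
Proof.
move/matrixP => e; move: (e 0 0) (e 1 0) (e ord_max ord_max); rewrite !mxE /=.
case: z z' {e} => x y [x' y'] /= -> -> e; split=> //.
by case: b b' e => -[] //; rewrite ?expr1 ?expr0; lra.
Qed.

(* A rotation is its own cofactor matrix, so its last column is determined by
   the other two. *)
Lemma rotation_ext S T : is_rotation S -> is_rotation T ->
  (forall i, S i 0 = T i 0) -> (forall i, S i 1 = T i 1) -> S = T.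
Proof.
move=> [SS dS] [TT dT] e0 e1.
have adjE (U : 'M[R]_3) : U *m U^T = 1%:M -> \det U = 1 -> U^T = \adj U.
  by move=> UU dU; rewrite -[RHS]mul1mx -(mulmx1C UU) -mulmxA mul_mx_adj dU mulmx1.
have cof (U : 'M[R]_3) i : U *m U^T = 1%:M -> \det U = 1 -> U i ord_max = cofactor U i ord_max.
  by move=> UU dU; have /matrixP/(_ ord_max i) := adjE U UU dU; rewrite !mxE.
apply/matrixP => i j; have [->|jm] := eqVneq j ord_max; last first.
  case: j jm => -[|[|[|//]]] jp // _.
    by rewrite (_ : Ordinal jp = 0) ?e0 //; apply: val_inj.
  by rewrite (_ : Ordinal jp = 1) ?e1 //; apply: val_inj.
rewrite !cof // /cofactor; congr (_ * \det _); apply/matrixP => a b; rewrite !mxE.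
case: b => -[|[|//]] bp.
  by rewrite (_ : lift ord_max _ = 0) ?e0 //; apply: val_inj.
by rewrite (_ : lift ord_max _ = 1) ?e1 //; apply: val_inj.
Qed.

Lemma equator_inj : injective (@equator R).
Proof. by move=> [x y] [x' y'] /col3_inj[/= -> -> _]. Qed.

(** As [Im w] is nonzero, the two vectors span the equatorial plane; hence the first two columns
    agree and [rotation_ext] applies. *)
Lemma rotation_equator_ext S T : is_rotation S -> is_rotation T ->
  S *m equator 1 = T *m equator 1 -> S *m equator w = T *m equator w -> S = T.
Proof.
move=> rS rT; have Im0 := lt0r_neq0 (Im_omega_gt0 R).
have mE (U : 'M[R]_3) z i :
    (U *m equator z) i 0 = U i 0 * complex.Re z + U i 1 * complex.Im z.
  rewrite mxE !big_ord_recl big_ord0 !mxE /= mulr0 !addr0.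
  by congr (U i _ * _ + U i _ * _); apply: val_inj.
move=> /colP e1 /colP ew.
have e0 i : S i 0 = T i 0 by have := e1 i; rewrite !mE /= !mulr1 !mulr0 !addr0.
apply: rotation_ext => // i; have := ew i; rewrite !mE e0 => /addrI.
exact: mulIf.
Qed.

End Rotations.

(** * Rotations that preserve the trine triangle *)

Section Triangle.
Variable R : realType.
Local Open Scope complex_scope.
Notation w := (omega R).
Implicit Types (S : 'M[R]_3) (m : 'I_3 -> 'cV[R]_3).

Definition trine_vertex (i : 'I_3) : 'cV[R]_3 := equator (w ^+ i).

Lemma trine_vertexE :
  [/\ trine_vertex 0 = col3 1 0 0,
      trine_vertex 1 = col3 (- 2^-1) (complex.Im w) 0 &
      trine_vertex ord_max = col3 (- 2^-1) (- complex.Im w) 0].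
Proof.
split; rewrite /trine_vertex; first by rewrite expr0.
  by rewrite expr1 /equator Re_omega.
rewrite -[w ^+ _]/(w ^+ 2) -conj_omega -Re_omega.
by case: w.
Qed.

Lemma sum_I3 (V : nmodType) (F : 'I_3 -> V) : \sum_i F i = F 0 + F 1 + F ord_max.
Proof.
rewrite !big_ord_recl big_ord0 addr0 addrA.
by congr (F _ + F _ + F _); apply: val_inj.
Qed.

Lemma sumsq_col3 (a b c : R) :
  \sum_(i < 3) (col3 a b c i 0) ^+ 2 = a ^+ 2 + b ^+ 2 + c ^+ 2.
Proof. by rewrite sum_I3 !mxE. Qed.

Lemma rotation_sumsq S (v : 'cV[R]_3) : is_rotation S ->
  \sum_i ((S *m v) i 0) ^+ 2 = \sum_i (v i 0) ^+ 2.
Proof.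
move=> [SS _].
have dot (u : 'cV[R]_3) : \sum_i (u i 0) ^+ 2 = (u^T *m u) 0 0.
  by rewrite mxE; apply: eq_bigr => i _; rewrite mxE expr2.
by rewrite !dot trmx_mul -mulmxA (mulmxA S^T) (mulmx1C SS) mul1mx.
Qed.

(* With weights a, b, c summing to 1 the squared norm is 1 - 3 (a b + b c + c a). *)
Lemma triangle_unit (p : 'cV[R]_3) : triangle trine_vertex p ->
  \sum_i (p i 0) ^+ 2 = 1 -> exists i, p = trine_vertex i.
Proof.
case=> wt [wt_ge0]; rewrite sum_I3 => wt1 ->.
have [v0 v1 v2] := trine_vertexE.
rewrite (sum_I3 (fun i => wt i *: trine_vertex i)).
move: (wt_ge0 0) (wt_ge0 1) (wt_ge0 ord_max) wt1.
move: (wt 0) (wt 1) (wt ord_max) => a b c a0 b0 c0 abc.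
have e : a *: trine_vertex 0 + b *: trine_vertex 1 + c *: trine_vertex ord_max =
    col3 (a - b / 2 - c / 2) ((b - c) * complex.Im w) 0.
  by rewrite v0 v1 v2 [LHS]col3_eta !mxE /=; congr col3; ring.
rewrite e sumsq_col3 exprMn Im_omega2 expr0n addr0 => n1.
have ab : 0 <= a * b by exact: mulr_ge0.
have bc : 0 <= b * c by exact: mulr_ge0.
have ca : 0 <= c * a by exact: mulr_ge0.
have s0 : a * b + b * c + c * a = 0.
  have : (a + b + c) ^+ 2 = 1 by rewrite abc expr1n.
  by nra.
have ab0 : a * b = 0 by lra.
have bc0 : b * c = 0 by lra.
have ca0 : c * a = 0 by lra.
(* All pairwise products vanish, so two of the weights are 0 and the third is 1. *)
rewrite -e; move/eqP: ab0; rewrite mulf_eq0 => /orP[]/eqP z.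
  move/eqP: bc0; rewrite mulf_eq0 => /orP[]/eqP z'.
    exists ord_max; rewrite z z' !scale0r !add0r (_ : c = 1) ?scale1r //; lra.
  exists 1; rewrite z z' !scale0r add0r addr0 (_ : b = 1) ?scale1r //; lra.
move/eqP: ca0; rewrite mulf_eq0 => /orP[]/eqP z'.
  exists 0; rewrite z z' !scale0r !addr0 (_ : a = 1) ?scale1r //; lra.
exists ord_max; rewrite z z' !scale0r !add0r (_ : c = 1) ?scale1r //; lra.
Qed.

Lemma trine_vertex_triangle i : triangle trine_vertex (trine_vertex i).
Proof.
exists (fun j => (j == i)%:R); split=> [j||]; first exact: ler0n.
  by rewrite (bigD1 i) //= eqxx big1 ?addr0 // => j /negPf ->.
by rewrite (bigD1 i) //= eqxx scale1r big1 ?addr0 // => j /negPf ->; rewrite scale0r.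
Qed.

(** The image stays in the triangle and keeps norm 1, so [triangle_unit] makes it a vertex. *)
Lemma invariant_vertex S i : is_rotation S ->
  leaves_invariant S (triangle trine_vertex) ->
  exists j, S *m trine_vertex i = trine_vertex j.
Proof.
move=> rS inv; apply: triangle_unit.
  by rewrite -inv; exists (trine_vertex i) => //; exact: trine_vertex_triangle.
by rewrite rotation_sumsq // sumsq_col3 sqr_Re_Im ?norm_omegaX // expr0n addr0.
Qed.

(** Convex weights are carried along the permutation [f]: the image of a point has its weights
    relabelled by the inverse [g]. *)
Lemma permuted_vertices_invariant S m (f : 'I_3 -> 'I_3) : injective f ->
  (forall i, S *m m i = m (f i)) -> leaves_invariant S (triangle m).
Proof.
move=> f_inj Sm; have [g fK gK] := injF_bij f_inj.
apply/seteqP; split=> [_ [_ [a [a0 a1 ->]] <-]|_ [a [a0 a1 ->]]].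
  exists (a \o g); split=> [i||]; first exact: a0.
    by rewrite -a1 [RHS](reindex_inj (can_inj gK)).
  rewrite mulmx_sumr [RHS](reindex_inj f_inj); apply: eq_bigr => i _ /=.
  by rewrite fK -scalemxAr Sm.
(* The preimage gives vertex [i] the weight that the target gives to [f i]. *)
exists (\sum_i a (f i) *: m i); last first.
  rewrite mulmx_sumr [RHS](reindex_inj f_inj); apply: eq_bigr => i _ /=.
  by rewrite -scalemxAr Sm.
exists (a \o f); split=> [i||] //; first exact: a0.
by rewrite -a1 [RHS](reindex_inj f_inj).
Qed.

Lemma dih_rot_vertex b (s i : 'I_3) :
  dih_rot b (w ^+ s) *m trine_vertex i = trine_vertex (if b then s - i else s + i).
Proof.
rewrite dih_rot_equator /trine_vertex; congr equator.
case: b; rewrite omega_ord ?omega_ordN //; congr (_ * _).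
exact/conj_unit/norm_omegaX.
Qed.

Lemma dih_rot_invariant b (s : 'I_3) :
  leaves_invariant (dih_rot b (w ^+ s)) (triangle trine_vertex).
Proof.
apply: permuted_vertices_invariant (dih_rot_vertex b s).
by case: b => i j /addrI // /oppr_inj.
Qed.

Lemma trine_vertex_inj : injective trine_vertex.
Proof. by move=> i j /equator_inj/omega_ord_inj. Qed.

(** The image [j0] of vertex 0 gives the turn, and the sign in [j1 = j0 + 1] or [j1 = j0 - 1]
    decides the flip; agreement on these two vertices suffices. *)
Lemma invariant_rotation S : is_rotation S ->
  leaves_invariant S (triangle trine_vertex) -> exists b (s : 'I_3), S = dih_rot b (w ^+ s).
Proof.
move=> rS inv.
have [j0 e0] := invariant_vertex 0 rS inv; have [j1 e1] := invariant_vertex 1 rS inv.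
have j01 : j0 != j1.
  apply/eqP => j01; rewrite j01 -e1 in e0.
  have := congr1 (mulmx S^T) e0; rewrite !mulmxA (mulmx1C rS.1) !mul1mx.
  by move/trine_vertex_inj.
have agree b : trine_vertex j1 = trine_vertex (if b then j0 - 1 else j0 + 1) ->
    S = dih_rot b (w ^+ j0).
  move=> e; apply: rotation_equator_ext => //.
  - exact/dih_rot_rotation/norm_omegaX.
  - rewrite -[1](expr0 w) -[equator _]/(trine_vertex 0) e0 dih_rot_vertex.
    by rewrite subr0 addr0 if_same.
  - by rewrite -[w in equator w]expr1 -[equator _]/(trine_vertex 1) e1 dih_rot_vertex.
by case: (I3_neq j01) => j1E; [exists false, j0|exists true, j0];
  apply: agree; rewrite j1E.
Qed.

Lemma trine_equilateral : equilateral trine_vertex.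
Proof.
have [v0 v1 v2] := trine_vertexE; have s2 := Im_omega2 R.
(* The side of an equilateral triangle inscribed in the unit circle. *)
exists (Num.sqrt 3); first by rewrite sqrtr_gt0 ltr0n.
have sub (a b c a' b' c' : R) : col3 a b c - col3 a' b' c' = col3 (a - a') (b - b') (c - c').
  by rewrite [LHS]col3_eta !mxE.
have I3 (i : 'I_3) : [\/ i = 0, i = 1 | i = ord_max].
  by case: i => [[|[|[|//]]] ip]; [constructor 1|constructor 2|constructor 3]; apply: val_inj.
move=> i j; rewrite /euclidean_norm => ij; congr Num.sqrt; move: ij.
by case: (I3 i) (I3 j) => -> [] -> //= _; rewrite ?v0 ?v1 ?v2 sub sumsq_col3; nra.
Qed.

End Triangle.

(** * Classification, closed forms and triangle symmetries combined *)

Theorem mainTheorem4 (R : realType) (m : 'I_3 -> 'cV[R]_3)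
    (m_bloch : forall i, ketbra (trine_ket R i) = bloch_state (m i)) :
  let V := fun k : 'I_6 => (six_unitaries R)`_k in
  [/\ (forall W : 'M[R[i]]_2,
         trine_incoherent_unitary W <->
         exists (k : 'I_6) (c : R[i]), `|c| = 1 /\ W = c *: V k),
      (forall (k l : 'I_6) (c : R[i]), `|c| = 1 -> V k = c *: V l -> k = l),
      six_unitaries R =
        [:: 1%:M; qubit_rot (e_z R) (2 * pi / 3); qubit_rot (e_z R) (4 * pi / 3);
            qubit_rot (m (inord 0)) pi; qubit_rot (m (inord 1)) pi;
            qubit_rot (m (inord 2)) pi],
      equilateral m
    & exists Q : 'I_6 -> 'M[R]_3,
        [/\ injective Q,
            forall k, bloch_action (V k) (Q k)
          & forall S : 'M[R]_3,
              is_rotation S /\ leaves_invariant S (triangle m) <->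
              exists k, S = Q k]].
Proof.
have {m_bloch}-> : m = trine_vertex R by apply/funext => i; exact: trine_bloch.
have nz (c : R[i]) : `|c| = 1 -> c != 0 by move=> c1; rewrite -normr_eq0 c1 oner_eq0.
move=> V; split.
- move=> W; split.
    move/incoherent_dih => [b [s [c [c1 ->]]]].
    have [k [<- <-]] := flip_turn_surj b s.
    have [p p1 Vk] := six_unitaries_dih R k.
    (* Dividing by [p] absorbs the phase between [V k] and its normalised form. *)
    exists k, (c / p); split; first by rewrite normf_div c1 p1 divr1.
    by rewrite /V Vk scalerA divfK ?nz.
  case=> k [c [c1 ->]]; have [p p1 Vk] := six_unitaries_dih R k.
  by rewrite /V Vk scalerA; apply: dih_incoherent; rewrite normrM c1 p1 mulr1.
- move=> k l c c1; rewrite /V.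
  have [p p1 ->] := six_unitaries_dih R k; have [q q1 ->] := six_unitaries_dih R l.
  rewrite scalerA => /dih_proj_inj[]; rewrite ?mulf_neq0 ?nz // => fkl /omega_ord_inj.
  exact: flip_turn_inj.
- have [s0 s1 s2] : [/\ 2 * pi / 3 / 2 = pi / 3 :> R, 4 * pi / 3 / 2 = 2 * pi / 3 :> R
      & 2 * pi * (1 / 2) / 3 = pi / 3 :> R] by split; field.
  rewrite /six_unitaries scalar_mx2 !rot_z s0 s1.
  rewrite (_ : omega_pow (- (1 / 2)) = expi (- (pi / 3))); last first.
    by rewrite -s2 /omega_pow; congr expi; field.
  rewrite (_ : omega_pow (1 / 2) = expi (pi / 3)); last by rewrite -s2.
  rewrite !rot_equator_pi ?norm_omegaX // !inordK // expr0 invr1 !mulr1.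
  have lower n : - 'i%C * omega R ^+ n = omega_pow (n%:R - 3 / 4).
    by rewrite omega_powD omega_pow_nat oppi_omega_pow mulrC.
  (* The added period 3 brings the exponents for [n = 1, 2] to [5/4] and [1/4], as in the list. *)
  have upper n : - 'i%C / omega R ^+ n = omega_pow (- n%:R - 3 / 4 + 3).
    by rewrite omega_powD3 omega_powD omega_powN omega_pow_nat oppi_omega_pow mulrC.
  rewrite !lower !upper.
  congr [:: _; _; _; _; _; _].
  - by congr mx2; rewrite /omega expiN conj_unit ?norm_expi.
  - by congr mx2; congr omega_pow; field.
  - by congr mx2; congr omega_pow; field.
- exact: trine_equilateral.
(* The phase of [V k] is dropped, since conjugation does not see it. *)
exists (fun k => dih_rot (flip k) (omega R ^+ turn k)); split.
- by move=> k l /dih_rot_inj[fkl /omega_ord_inj]; exact: flip_turn_inj.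
- move=> k; have [p p1 Vk] := six_unitaries_dih R k.
  by rewrite /V Vk; apply: dih_bloch_action => //; exact: norm_omegaX.
move=> S; split.
  case=> rS /(invariant_rotation rS)[b [s ->]].
  by have [k [<- <-]] := flip_turn_surj b s; exists k.
case=> k ->; split; last exact: dih_rot_invariant.
exact/dih_rot_rotation/norm_omegaX.
Qed.
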